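(* There is an absolute constant $C>0$ such that the following holds. Fix $j\in\mathbb N$ and write $\phi=\phi_j$, $\lambda=\lambda_j$. For all $x\in(0,1]$ such that $\phi'(x)$ exists, $$|x\phi'(x)|\le C\,|\lambda|^3(\log|\lambda|)^2.$$
   Context: Let $K:[0,1]\times[0,1]\to\mathbb R$ be defined by $K(x,y)=\frac12-\{(xy)^{-1}\}$ if $0<x,y\le 1$, and $K(x,y)=0$ if $0\le x,y\le1$ and $xy=0$, where $\{\alpha\}=\alpha-\lfloor\alpha\rfloor$. Let $L^2([0,1])$ denote the space of real-valued Lebesgue measurable square-integrable functions on $[0,1]$, with $\langle f,g\rangle=\int_0^1 f(x)g(x)\,dx$ and $\|f\|=\langle f,f\rangle^{1/2}$. A function $\phi$ is an eigenfunction of $K$ (with eigenvalue $\lambda\in\mathbb R$) if $\phi\in L^2([0,1])$, $\|\phi\|>0$, and $\phi(x)=\lambda\int_0^1 K(x,y)\phi(y)\,dy$ for every $x\in[0,1]$. Let $\phi_1,\phi_2,\ldots$ be a maximal orthonormal system in $L^2([0,1])$ of eigenfunctions of $K$, $\phi_j$ having the nonzero real eigenvalue $\lambda_j$, numbered so that $0<|\lambda_1|\le|\lambda_2|\le\cdots$ and $\lambda_j\ge\lambda_{j+1}$ whenever $|\lambda_j|=|\lambda_{j+1}|$. At $x=1$, $\phi'(1)$ means the left-hand derivative. *)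

(* Defs.v *)
From HB Require Import structures.
From mathcomp Require Import all_boot all_order all_algebra.
From mathcomp Require Import all_classical all_reals all_analysis.
Set Implicit Arguments. Unset Strict Implicit. Unset Printing Implicit Defensive.
Import Order.TTheory GRing.Theory Num.Theory.
Import numFieldNormedType.Exports.
Local Open Scope classical_set_scope.
Local Open Scope ring_scope.

Section Defs.
Variable R : realType.

Definition frac (a : R) : R := a - (Num.floor a)%:~R.

(* K(x,y) = 1/2 - {(xy)^-1} if 0 < x, y; 0 if xy = 0 (only used on [0,1]^2) *)
Definition Kker (x y : R) : R :=
  if (0 < x) && (0 < y) then 2^-1 - frac ((x * y)^-1) else 0.

Definition leb := (@lebesgue_measure R).

Definition I01 : set R := `[(0:R), (1:R)].

Definition L2_01 (f : R -> R) : Prop :=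
  measurable_fun I01 f /\
  (\int[leb]_(x in I01) ((f x) ^+ 2)%:E < +oo)%E.

Definition inner01 (f g : R -> R) : R :=
  Rintegral leb I01 (fun x => f x * g x).

Definition norm01 (f : R -> R) : R := Num.sqrt (inner01 f f).

Definition eigenfun (phi : R -> R) (lam : R) : Prop :=
  L2_01 phi /\ 0 < norm01 phi /\
  forall x, 0 <= x <= 1 ->
    phi x = lam * Rintegral leb I01 (fun y => Kker x y * phi y).

Definition max_eigen_system (phi : nat -> R -> R) (lam : nat -> R) : Prop :=
  (forall j, lam j != 0 /\ eigenfun (phi j) (lam j)) /\
  (forall i j, inner01 (phi i) (phi j) = if i == j then 1 else 0) /\
  (forall j, `|lam j| <= `|lam j.+1|) /\
  (forall j, `|lam j| = `|lam j.+1| -> lam j.+1 <= lam j) /\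
  (forall psi mu, mu != 0 -> eigenfun psi mu ->
     ~ (forall j, inner01 psi (phi j) = 0)).

Definition deriv01 (f : R -> R) (x d : R) : Prop :=
  if x < 1 then is_derive x 1 f d
  else (fun h : R => h^-1 * (f (x + h) - f x)) @ (0%R)^'- --> d.

End Defs.

(* Main.v *)
Require Import Defs.
From HB Require Import structures.
From mathcomp Require Import all_boot all_order all_algebra.
From mathcomp Require Import all_classical all_reals all_analysis.
From mathcomp Require Import measurable_realfun ring lra.
Import Order.TTheory GRing.Theory Num.Theory.
Import numFieldNormedType.Exports.
Local Open Scope classical_set_scope.
Local Open Scope ring_scope.
Set Implicit Arguments.
Unset Strict Implicit.

(** Write [K(x,y) = k(xy)], [L = |lam|] and, for [1/2 <= q < 1],
    [D(x) = |phi(qx) - phi(x)|] and [J = int_0^1 D].  Since [|K| <= 1/2] and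
    [phi] has norm 1, [|phi| <= L/2] and [L >= 2].

    Substituting [z = qy] in [phi(qx) = lam int k(xqy) phi(y) dy] moves the
    dilation from the kernel to [phi], and gives
    [D(x) <= L/2 (J + (1-q) L)] for all [x]; used only on [0 <= y <= d], it
    bounds that part of the integral by [L/2 (int_0^d D + (1-q) L)].  For
    [x >= d] the part [y >= d] is at most
    [L^2/2 * (1/x) int_{xd}^1 |k(qu) - k(u)| du = O(L^2 (1-q) log(1/d) / x)].
    Integrating over [x >= d] with [d = L^-2] absorbs [J] into the left-hand
    side, so [J = O((1-q) L^2 log^2 L)] and [D(x) = O((1-q) L^3 log^2 L)];
    the theorem follows by letting [q] tend to 1 from below. *)

(** * Change of scale and integration of bounded functions over compact intervals *)

Section Toolbox.
Variable R : realType.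
Local Notation mu := (@lebesgue_measure R).
Local Notation itg a b f := (Rintegral mu `[a, b]%classic f).
Implicit Types (f g : R -> R) (a b c : R).


Lemma measurable_scale c :
  measurable_fun setT ( *%R c : measurableTypeR R -> measurableTypeR R).
Proof. exact: mulrl_measurable. Qed.

Definition scaled_lebesgue (c : {posnum R}) :
    {measure set (measurableTypeR R) -> \bar R} :=
  mscale (c%:num%:nng)
    (measure_function_pushforward__canonical__measure_function_Measure
       mu (measurable_scale c%:num)).

(** The preimage under multiplication by [c] has its length divided by [c], which the factor [c]
    restores; by uniqueness of Lebesgue measure, half-open intervals suffice. *)
Lemma scaled_lebesgueE (c : {posnum R}) (A : set (measurableTypeR R)) : measurable A ->
  mu A = scaled_lebesgue c A.
Proof.
move=> mA.
apply: lebesgue_measure_unique => // _ [[a b]] _ <-.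
rewrite /scaled_lebesgue/= /mscale/= /pushforward.
have -> : *%R c%:num @^-1` `]a, b]%classic = `](a / c%:num), (b / c%:num)]%classic.
  apply/seteqP; split => x /=; rewrite !in_itv/=.
    by rewrite ltr_pdivrMr// ler_pdivlMr// (mulrC x).
  by rewrite ltr_pdivrMr// ler_pdivlMr// (mulrC x).
rewrite !lebesgue_measure_itv/= !lte_fin ltr_pM2r//.
case: ifP => _; last by rewrite mule0.
by rewrite -!EFinD -EFinM -mulrBl mulrCA divff// mulr1.
Qed.


Lemma ge0_integral_scale c a b (g : R -> \bar R) : 0 < c ->
  measurable_fun setT g -> (forall x, 0 <= g x)%E ->
  (\int[mu]_(x in `[(c * a)%R, (c * b)%R]) g x =
   c%:E * \int[mu]_(x in `[a, b]) g (c * x)%R)%E.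
Proof.
move=> c0 mg g0; pose cp := PosNum c0.
rewrite (eq_measure_integral (scaled_lebesgue cp)); last first.
  by move=> A mA _; exact: scaled_lebesgueE.
rewrite ge0_integral_mscale//; last exact: measurable_funTS.
rewrite (ge0_integral_pushforward (measurable_scale c))//; last exact: measurable_funTS.
congr (_ * integral _ _ _)%E.
apply/seteqP; split => x /=; rewrite !in_itv/= !ler_pM2l//.
Qed.

(** Measurability is asked globally, so that it survives dilations and restriction to any
    subinterval; the bound is local, so that [x^-1] qualifies away from 0. *)
Definition bounded_on a b f :=
  measurable_fun setT f /\ exists M, forall x, a <= x <= b -> `|f x| <= M.

Lemma bounded_on_integrable a b f : bounded_on a b f ->
  mu.-integrable `[a, b] (EFin \o f).
Proof.
move=> [mf [M fM]]; apply: measurable_bounded_integrable => //.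
- rewrite /= lebesgue_measure_itv/=; case: ifP => _ //.
  by rewrite -EFinD ltry.
- exact: measurable_funTS.
- exists M; split; first exact: num_real.
  move=> N MN x; rewrite /= in_itv/= => /fM fxM.
  exact: (le_trans fxM (ltW MN)).
Qed.

Lemma bounded_onD a b f g : bounded_on a b f -> bounded_on a b g ->
  bounded_on a b (fun x => f x + g x).
Proof.
move=> [mf [M fM]] [mg [N gN]]; split; first exact: measurable_funD.
by exists (M + N) => x xab; rewrite (le_trans (ler_normD _ _))// lerD ?fM ?gN.
Qed.

Lemma bounded_onB a b f g : bounded_on a b f -> bounded_on a b g ->
  bounded_on a b (fun x => f x - g x).
Proof.
move=> [mf [M fM]] [mg [N gN]]; split; first exact: measurable_funB.
by exists (M + N) => x xab; rewrite (le_trans (ler_normB _ _))// lerD ?fM ?gN.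
Qed.

Lemma bounded_onM a b f g : bounded_on a b f -> bounded_on a b g ->
  bounded_on a b (fun x => f x * g x).
Proof.
move=> [mf [M fM]] [mg [N gN]]; split; first exact: measurable_funM.
by exists (M * N) => x xab; rewrite normrM ler_pM ?fM ?gN.
Qed.

Lemma bounded_on_norm a b f : bounded_on a b f -> bounded_on a b (fun x => `|f x|).
Proof.
move=> [mf [M fM]]; split; first exact: measurableT_comp.
by exists M => x /fM; rewrite normr_id.
Qed.

Lemma bounded_on_cst a b c : bounded_on a b (fun=> c).
Proof. by split; [exact: measurable_cst | exists `|c|]. Qed.

Lemma bounded_on_scale c a b f : 0 < c -> bounded_on (c * a) (c * b) f ->
  bounded_on a b (fun x => f (c * x)).
Proof.
move=> c0 [mf [M fM]]; split.
  by apply: (measurableT_comp mf); exact: mulrl_measurable.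
by exists M => x xab; apply: fM; rewrite !ler_pM2l.
Qed.

Lemma itgD a b f g : bounded_on a b f -> bounded_on a b g ->
  itg a b (fun x => f x + g x) = itg a b f + itg a b g.
Proof. by move=> bf bg; apply: RintegralD => //; exact: bounded_on_integrable. Qed.

Lemma itgB a b f g : bounded_on a b f -> bounded_on a b g ->
  itg a b (fun x => f x - g x) = itg a b f - itg a b g.
Proof. by move=> bf bg; apply: RintegralB => //; exact: bounded_on_integrable. Qed.

Lemma itgZ a b c f : bounded_on a b f -> itg a b (fun x => c * f x) = c * itg a b f.
Proof. by move=> bf; apply: RintegralZl => //; exact: bounded_on_integrable. Qed.

Lemma itg_le a b f g : bounded_on a b f -> bounded_on a b g ->
  (forall x, a <= x <= b -> f x <= g x) -> itg a b f <= itg a b g.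
Proof.
move=> bf bg fg; apply: le_Rintegral => //; try exact: bounded_on_integrable.
Qed.

Lemma itg_ge0 a b f : (forall x, a <= x <= b -> 0 <= f x) -> 0 <= itg a b f.
Proof.
by move=> f0; apply: Rintegral_ge0 => // x; rewrite /= in_itv/=; exact: f0.
Qed.

Lemma itg_eq a b f g : (forall x, a <= x <= b -> f x = g x) -> itg a b f = itg a b g.
Proof.
by move=> fg; apply: eq_Rintegral => x; rewrite inE/= in_itv/=; exact: fg.
Qed.

Lemma itg_norm a b f : bounded_on a b f -> `|itg a b f| <= itg a b (fun x => `|f x|).
Proof. by move=> bf; apply: le_normr_Rintegral => //; exact: bounded_on_integrable. Qed.

Lemma itg_cst a b c : a <= b -> itg a b (fun=> c) = c * (b - a).
Proof.
move=> ab; rewrite Rintegral_cst//= lebesgue_measure_itv/= lte_fin.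
move: ab; rewrite le_eqVlt => /predU1P[->|->]; last by rewrite -EFinD.
by rewrite ltxx subrr.
Qed.

Lemma itg_le_cst a b f M : a <= b -> bounded_on a b f ->
  (forall x, a <= x <= b -> f x <= M) -> itg a b f <= M * (b - a).
Proof.
by move=> ab bf fM; rewrite -itg_cst//; apply: itg_le => //; exact: bounded_on_cst.
Qed.

Lemma itg_split b a c f : a <= b -> b <= c -> bounded_on a c f ->
  itg a c f = itg a b f + itg b c f.
Proof.
move=> ab bc bf; have i1 := bounded_on_integrable bf.
rewrite -(@Rintegral_itv_obnd_cbnd _ b); last first.
  by apply: integrableS i1 => //; apply: subset_itvr; rewrite bnd_simp.
by rewrite -(Rintegral_itvB i1) ?bnd_simp// addrC subrK.
Qed.

(** Positive and negative parts are scaled separately; integrability makes both integrals finite, so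
    that they can be subtracted in [R]. *)
Lemma itg_scale c a b f : 0 < c -> bounded_on (c * a) (c * b) f ->
  itg (c * a) (c * b) f = c * itg a b (fun x => f (c * x)).
Proof.
move=> c0 bf.
have mf : measurable_fun setT (EFin \o f) by apply/measurable_EFinP; case: bf.
have := bounded_on_integrable bf.
have := bounded_on_integrable (bounded_on_scale c0 bf) => i1 i2.
rewrite /Rintegral integralE [in RHS]integralE.
rewrite !ge0_integral_scale//; last 2 first.
- exact: measurable_funeneg.
- exact: measurable_funepos.
rewrite (@eq_integral _ _ _ mu `[a, b] ((fun x => (f (c * x))%:E)^\+)%E
  (fun x => (fun x0 => (f x0)%:E)^\+ (c * x)%R)%E); last first.
  by move=> x _; rewrite !funeposE.
rewrite (@eq_integral _ _ _ mu `[a, b] ((fun x => (f (c * x))%:E)^\-)%E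
  (fun x => (fun x0 => (f x0)%:E)^\- (c * x)%R)%E); last first.
  by move=> x _; rewrite !funenegE.
have ipos : (\int[mu]_(x in `[a, b]) (fun x => (f (c * x))%:E)^\+ x)%E \is a fin_num.
  by apply: integrable_pos_fin_num i1.
have ineg : (\int[mu]_(x in `[a, b]) (fun x => (f (c * x))%:E)^\- x)%E \is a fin_num.
  by apply: integrable_neg_fin_num i1.
rewrite -(fineK ipos) -(fineK ineg).
by rewrite -!EFinM -!EFinB/= mulrBr.
Qed.

Lemma measurable_inv : measurable_fun setT (@GRing.inv R).
Proof.
(* Elsewhere than at 0 this is [x / x^2]; at 0 both sides vanish because [0^-1 = 0]. *)
have -> : @GRing.inv R = fun x => x * (`|x| ^+ 2) `^ (-1).
  apply/funext => x; rewrite powR_inv1 ?exprn_ge0// -normrX ger0_norm ?sqr_ge0//.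
  by have [->|x0] := eqVneq x 0; [rewrite mul0r invr0 | field].
apply: measurable_funM => //.
apply: (measurableT_comp (measurable_powR _)) => //.
exact: measurable_funX.
Qed.

Lemma measurable_floor : measurable_fun setT (fun x : R => (Num.floor x)%:~R : R).
Proof.
apply: nondecreasing_measurable => // x y xy.
by rewrite ler_int le_floor.
Qed.

Lemma itg_inv a b : 0 < a -> a <= b -> itg a b (fun x => x^-1) = ln b - ln a.
Proof.
move=> a0; rewrite le_eqVlt => /predU1P[->|ab].
  by rewrite set_itv1 Rintegral_set1 subrr.
have b0 : 0 < b := lt_trans a0 ab.
rewrite /Rintegral (@continuous_FTC2 _ _ (@ln R))//.
- apply: continuous_in_subspaceT => x; rewrite inE/= in_itv/= => /andP[ax _].
  by apply: inv_continuous; rewrite gt_eqF// (lt_le_trans a0).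
- split.
  + move=> x; rewrite in_itv/= => /andP[ax _].
    by have [] := is_derive1_ln (lt_trans a0 ax).
  + by apply: cvg_at_right_filter; exact: continuous_ln.
  + by apply: cvg_at_left_filter; exact: continuous_ln.
- move=> x; rewrite in_itv/= => /andP[ax _].
  by rewrite derive1E; apply: derive_val; exact: is_derive1_ln (lt_trans a0 ax).
Qed.
End Toolbox.

(** * The one-variable kernel and its variation under dilation *)

Section Kernel.
Variable R : realType.
Local Notation mu := (@lebesgue_measure R).
Local Notation itg a b f := (Rintegral mu `[a, b]%classic f).
Implicit Types (a b c q t u x y : R).

Definition kern t : R := if 0 < t then 2^-1 - Defs.frac t^-1 else 0.

Lemma KkerE x y : 0 <= x -> Kker x y = kern (x * y).
Proof.
rewrite le_eqVlt /Kker /kern => /predU1P[<-|x0]; first by rewrite mul0r ltxx.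
by rewrite x0 pmulr_rgt0.
Qed.

Lemma kern_bound t : `|kern t| <= 2^-1.
Proof.
rewrite /kern; case: ifP => _; last by rewrite normr0; lra.
rewrite /Defs.frac; have /andP[] := floor_itv t^-1; rewrite intrD.
by move: (Num.floor _)%:~R => z z1 z2; rewrite ler_norml; apply/andP; split; lra.
Qed.

Lemma measurable_kern : measurable_fun setT kern.
Proof.
apply: measurable_fun_ifT => //; first exact: measurable_fun_ltr.
apply: measurable_funB => //; apply: measurable_funB; first exact: measurable_inv.
exact: (measurableT_comp (@measurable_floor R) (@measurable_inv R)).
Qed.

Lemma bounded_on_kern a b c : bounded_on a b (fun y => kern (c * y)).
Proof.
split; first by apply: (measurableT_comp measurable_kern); exact: mulrl_measurable.
by exists 2^-1 => x _; exact: kern_bound.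
Qed.

Lemma bounded_on_inv a b : 0 < a -> bounded_on a b (@GRing.inv R).
Proof.
move=> a0; split; first exact: measurable_inv.
exists a^-1 => x /andP[ax _]; have x0 := lt_le_trans a0 ax.
by rewrite gtr0_norm ?invr_gt0// lef_pV2.
Qed.

(** The step part of the kernel: [kern u = 1/2 - u^-1 + flinv u] for [u > 0]. *)
Definition flinv u : R := (Num.floor u^-1)%:~R.

Lemma flinv_ge0 u : 0 <= u -> 0 <= flinv u.
Proof. by move=> u0; rewrite /flinv ler0z floor_ge0 invr_ge0. Qed.

Lemma flinv_le u : flinv u <= u^-1.
Proof. exact: floor_le. Qed.

Lemma bounded_on_flinv a b : 0 < a -> bounded_on a b flinv.
Proof.
move=> a0; split.
  exact: (measurableT_comp (@measurable_floor R) (@measurable_inv R)).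
exists a^-1 => x /andP[ax _]; have x0 := lt_le_trans a0 ax.
rewrite ger0_norm ?flinv_ge0 ?(ltW x0)//.
by rewrite (le_trans (flinv_le _))// lef_pV2.
Qed.

(** Passing from [u] to [q * u] increases both [u^-1] and [flinv u], so the triangle inequality
    leaves two nonnegative differences without absolute values, each easy to integrate. *)
Lemma kern_diff q u : 0 < q <= 1 -> 0 < u ->
  `|kern (q * u) - kern u| <= (q^-1 - 1) * u^-1 + (flinv (q * u) - flinv u).
Proof.
move=> /andP[q0 q1] u0; rewrite /kern mulr_gt0// u0.
rewrite /Defs.frac -/(flinv u) -/(flinv (q * u)).
have fle : flinv u <= flinv (q * u).
  rewrite /flinv ler_int le_floor// lef_pV2 ?posrE ?mulr_gt0//.
  by rewrite ger_pMl.
have ile : u^-1 <= q^-1 * u^-1.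
  by rewrite ler_peMl ?invr_ge0 ?(ltW u0)// invf_ge1.
rewrite invfM; move: fle ile; set s := q^-1 * u^-1.
move: (flinv _) (flinv _) => z w h1 h2.
by rewrite mulrBl mul1r -/s ler_norml; apply/andP; split; lra.
Qed.

(** The reciprocal part of [kern_diff] integrates to [(q^-1 - 1) (- ln a)]; rescaling shows that the
    floor part costs a comparable amount, although its jumps are of size at least 1. *)
Lemma itg_kern_diff q a : 2^-1 <= q < 1 -> 0 < a <= 1 ->
  itg a 1 (fun u => `|kern (q * u) - kern u|) <= 4 * (1 - q) * (1 - ln a).
Proof.
move=> /andP[q2 q1] /andP[a0 a1].
have q0 : 0 < q by lra.
have qa0 : 0 < q * a by rewrite mulr_gt0.
have qaa : q * a <= a by rewrite ger_pMl// ltW.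
have binv : bounded_on a 1 (fun u : R => (q^-1 - 1) * u^-1).
  by apply: bounded_onM; [exact: bounded_on_cst | exact: bounded_on_inv].
have bfl : bounded_on a 1 flinv by exact: bounded_on_flinv.
have bflq : bounded_on a 1 (fun u => flinv (q * u)).
  by apply: bounded_on_scale => //; exact: bounded_on_flinv.
have bd : bounded_on a 1 (fun u => flinv (q * u) - flinv u) by exact: bounded_onB.
have bk : bounded_on a 1 (fun u => `|kern (q * u) - kern u|).
  apply: bounded_on_norm; apply: bounded_onB; first exact: bounded_on_kern.
  have := bounded_on_kern a 1 1.
  by under [X in bounded_on _ _ X -> _]eq_fun do rewrite mul1r.
apply: (@le_trans _ _ (itg a 1 (fun u => (q^-1 - 1) * u^-1 + (flinv (q * u) - flinv u)))).
  apply: itg_le => //; first exact: bounded_onD.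
  move=> u /andP[au _]; apply: kern_diff; first by rewrite q0 ltW.
  exact: lt_le_trans au.
rewrite itgD// itgB// itgZ; last exact: bounded_on_inv.
rewrite itg_inv// ln1 sub0r.
(* Rescaling, [q int_a^1 flinv(qu) du = int_{qa}^q flinv] exceeds
   [int_a^1 flinv] by at most [int_{qa}^a 1/u du]. *)
have sc : q * itg a 1 (fun u => flinv (q * u)) = itg (q * a) (q * 1) flinv.
  by rewrite itg_scale//; exact: bounded_on_flinv.
have sp1 : itg (q * a) 1 flinv = itg (q * a) (q * 1) flinv + itg (q * 1) 1 flinv.
  apply: itg_split; last exact: bounded_on_flinv.
    by rewrite ler_pM2l.
  by rewrite mulr1 ltW.
have sp2 : itg (q * a) 1 flinv = itg (q * a) a flinv + itg a 1 flinv.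
  by apply: itg_split => //; exact: bounded_on_flinv.
have p1 : 0 <= itg (q * 1) 1 flinv.
  apply: itg_ge0 => u /andP[qu _]; apply: flinv_ge0.
  by rewrite (le_trans _ qu)// mulr1 ltW.
have p2 : itg a 1 flinv <= - ln a.
  apply: (@le_trans _ _ (itg a 1 (@GRing.inv R))); last by rewrite itg_inv// ln1 sub0r.
  by apply: itg_le => //; [exact: bounded_on_inv | move=> u _; exact: flinv_le].
have p3 : itg (q * a) a flinv <= - ln q.
  apply: (@le_trans _ _ (itg (q * a) a (@GRing.inv R))); last first.
    by rewrite itg_inv// lnM ?posrE//; lra.
  apply: itg_le => //; [exact: bounded_on_flinv|exact: bounded_on_inv |].
  by move=> u _; exact: flinv_le.
(* This is [ln (1 + t) <= t] at [t = q^-1 - 1]. *)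
have p4 : - ln q <= q^-1 - 1.
  have qV0 : 0 < q^-1 by rewrite invr_gt0.
  have := @le_ln1Dx R (q^-1 - 1).
  by rewrite (addrC 1) subrK lnV ?posrE//; apply; lra.
have p5 : 0 <= - ln a by rewrite oppr_ge0 ln_le0.
have qV : q * q^-1 = 1 by rewrite divff// gt_eqF.
have e1 : q^-1 - 1 <= 2 * (1 - q).
  have : q^-1 <= 2 by rewrite -[2]invrK lef_pV2 ?posrE//; lra.
  nra.
have e0 : 0 <= q^-1 - 1 by rewrite subr_ge0 invf_ge1 ?ltW.
(* With [I] the integral of [flinv] over [[a, 1]], dividing [h] by [q] and subtracting [I] leaves
   [(q^-1 - 1) I], where [I <= - ln a] by [p2]. *)
have key : itg a 1 (fun u => flinv (q * u)) - itg a 1 flinv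
    <= (q^-1 - 1) * (- ln a) + q^-1 * (q^-1 - 1).
  have h : q * itg a 1 (fun u => flinv (q * u)) <= (q^-1 - 1) + itg a 1 flinv by lra.
  have : itg a 1 (fun u => flinv (q * u)) <= q^-1 * ((q^-1 - 1) + itg a 1 flinv).
    by rewrite mulrC ler_pdivlMr// mulrC.
  nra.
(* The total [2 (q^-1 - 1) (- ln a) + q^-1 (q^-1 - 1)] is at most [4 (1 - q) (1 - ln a)] by [e1] and
   [v2]. *)
have v2 : q^-1 <= 2 by rewrite -[2]invrK lef_pV2 ?posrE//; lra.
nra.
Qed.
End Kernel.

(** * Dilation estimate for bounded solutions of the integral equation *)

Section Dilation.
Variable R : realType.
Local Notation mu := (@lebesgue_measure R).
Local Notation itg a b f := (Rintegral mu `[a, b]%classic f).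
Variables (f : R -> R) (lam M q : R).
Hypothesis mf : measurable_fun setT f.
Hypothesis fM : forall x, `|f x| <= M.
Hypothesis fE : forall x, 0 <= x <= 1 ->
  f x = lam * itg 0 1 (fun y => kern (x * y) * f y).
Hypothesis qh : 2^-1 <= q < 1.

Let D y := `|f (q * y) - f y|.

Let q0 : 0 < q. Proof. by case/andP: qh; lra. Qed.
Let q1 : q < 1. Proof. by case/andP: qh. Qed.
Let M0 : 0 <= M. Proof. exact: le_trans (fM 0). Qed.

Let bf a b : bounded_on a b f.
Proof. by split => //; exists M. Qed.

Let bfq a b : bounded_on a b (fun y => f (q * y)).
Proof. by apply: bounded_on_scale => //; exact: bf. Qed.

Let bD a b : bounded_on a b D.
Proof. by apply: bounded_on_norm; apply: bounded_onB. Qed.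

Let bK c a b : bounded_on a b (fun y => kern (c * y) * f y).
Proof. by apply: bounded_onM => //; exact: bounded_on_kern. Qed.

Let bK2 x a b : bounded_on a b (fun y => kern (x * (q * y)) * f y).
Proof.
apply: bounded_onM => //.
apply: (@bounded_on_scale _ q _ _ (fun z => kern (x * z))) => //.
exact: bounded_on_kern.
Qed.

(** After the substitution both integrands carry the same kernel factor, so only the bound 1/2 on it
    matters. The Jacobian [q] and the leftover strip [[q * d, d]] each cost at most
    [(1 - q) * M / 2]. *)
Lemma itg_dilation_near0 d x : 0 <= d <= 1 ->
  `|itg 0 d (fun y => kern (x * (q * y)) * f y) - itg 0 d (fun y => kern (x * y) * f y)|
  <= 2^-1 * (itg 0 d D + 2 * (1 - q) * M).
Proof.
move=> /andP[d0 d1].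
have qd : q * d <= d by rewrite ler_piMl// ltW.
have bKqf : bounded_on 0 d (fun y => kern (x * (q * y)) * f (q * y)).
  by apply: (@bounded_on_scale _ q _ _ (fun z => kern (x * z) * f z)).
have bKqf' : bounded_on 0 d (fun y => q * (kern (x * (q * y)) * f (q * y))).
  by apply: bounded_onM => //; exact: bounded_on_cst.
have sc : itg 0 (q * d) (fun y => kern (x * y) * f y) =
    itg 0 d (fun y => q * (kern (x * (q * y)) * f (q * y))).
  by rewrite -[X in itg X _ _](mulr0 q) itg_scale// itgZ.
rewrite (@itg_split _ (q * d) 0 d (fun y => kern (x * y) * f y))//; last first.
  by rewrite mulr_ge0// ltW.
rewrite sc opprD addrA -itgB//.
rewrite (le_trans (ler_normB _ _))//.
have t1 : `|itg 0 d (fun y => kern (x * (q * y)) * f y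
                          - q * (kern (x * (q * y)) * f (q * y)))|
    <= 2^-1 * (itg 0 d D + (1 - q) * M).
  rewrite (le_trans (itg_norm _))//; first exact: bounded_onB.
  apply: (@le_trans _ _ (itg 0 d (fun y => 2^-1 * (D y + (1 - q) * M)))).
    apply: itg_le.
    - by apply: bounded_on_norm; apply: bounded_onB.
    - apply: bounded_onM; first exact: bounded_on_cst.
      by apply: bounded_onD => //; exact: bounded_on_cst.
    move=> y _.
    have -> : kern (x * (q * y)) * f y - q * (kern (x * (q * y)) * f (q * y)) =
      kern (x * (q * y)) * (q * (f y - f (q * y)) + (1 - q) * f y) by ring.
    rewrite normrM ler_pM ?kern_bound// (le_trans (ler_normD _ _))// lerD//.
      rewrite normrM distrC -/(D y) gtr0_norm// ler_piMl ?(ltW q1)//.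
      exact: normr_ge0.
    by rewrite normrM ger0_norm ?subr_ge0 ?(ltW q1)// ler_wpM2l// subr_ge0 ltW.
  rewrite itgZ; last by apply: bounded_onD => //; exact: bounded_on_cst.
  rewrite itgD//; last exact: bounded_on_cst.
  rewrite itg_cst// subr0 ler_pM2l// lerD2l.
  by rewrite ler_piMr// mulr_ge0// subr_ge0 ltW.
have t2 : `|itg (q * d) d (fun y => kern (x * y) * f y)| <= 2^-1 * M * (d - q * d).
  rewrite (le_trans (itg_norm _))//.
  apply: itg_le_cst => //; first exact: bounded_on_norm.
  by move=> y _; rewrite normrM ler_pM// kern_bound.
have t3 : 2^-1 * M * (d - q * d) <= 2^-1 * ((1 - q) * M).
  have : d * ((1 - q) * M) <= (1 - q) * M.
    by rewrite ler_piMl// mulr_ge0// subr_ge0 ltW.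
  lra.
lra.
Qed.

(** The case [d = 1]. Integrating it over [[0, 1]] could not absorb the integral of [D] once
    [|lam| >= 2], but over a short interval it gains the length. *)
Lemma dilation_le x : 0 <= x <= 1 ->
  D x <= `|lam| / 2 * (itg 0 1 D + 2 * (1 - q) * M).
Proof.
move=> /andP[x0 x1]; rewrite /D.
rewrite !fE ?x0 ?x1//; last first.
  by rewrite mulr_ge0 ?(ltW q0)//= mulr_ile1// ltW.
rewrite -mulrBr normrM -mulrA ler_wpM2l//.
rewrite (@itg_eq _ _ _ _ (fun y => kern (x * (q * y)) * f y)); last first.
  by move=> y _; rewrite mulrCA mulrA.
by apply: itg_dilation_near0; rewrite ler01 lexx.
Qed.

Lemma dilation_le_split d x : 0 < d -> d <= x <= 1 ->
  D x <= `|lam| / 2 * (itg 0 d D + 2 * (1 - q) * M)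
         + `|lam| * M * (4 * (1 - q) * (1 - 2 * ln d)) * x^-1.
Proof.
move=> d0 /andP[dx x1]; have x0 : 0 < x := lt_le_trans d0 dx.
have d1 : d <= 1 := le_trans dx x1.
rewrite {1}/D !fE ?x1 ?(ltW x0)//; last first.
  by rewrite mulr_ge0 ?(ltW q0) ?(ltW x0)//= mulr_ile1// ltW.
rewrite -mulrBr normrM -!(mulrA `|lam|) -(mulrA M) -mulrDr ler_wpM2l//.
rewrite (@itg_eq _ _ _ _ (fun y => kern (x * (q * y)) * f y)); last first.
  by move=> y _; rewrite mulrCA mulrA.
rewrite (@itg_split _ d 0 1 (fun y => kern (x * (q * y)) * f y)) ?(ltW d0)//.
rewrite (@itg_split _ d 0 1 (fun y => kern (x * y) * f y)) ?(ltW d0)//.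
rewrite opprD addrACA (le_trans (ler_normD _ _))// lerD//.
  by apply: itg_dilation_near0; rewrite ltW.
rewrite -itgB// (le_trans (itg_norm _))//; first exact: bounded_onB.
pose h u := `|kern (q * u) - kern u|.
have bh a b : bounded_on a b h.
  apply: bounded_on_norm; apply: bounded_onB; first exact: bounded_on_kern.
  have := @bounded_on_kern R a b 1.
  by under [X in bounded_on _ _ X -> _]eq_fun do rewrite mul1r.
have bhx a b : bounded_on a b (fun y => h (x * y)) by apply: bounded_on_scale.
apply: (@le_trans _ _ (itg d 1 (fun y => M * h (x * y)))).
  apply: itg_le.
  - by apply: bounded_on_norm; apply: bounded_onB.
  - by apply: bounded_onM => //; exact: bounded_on_cst.
  move=> y _; rewrite -mulrBl normrM mulrC (mulrCA x q) ler_wpM2r//.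
rewrite itgZ// ler_wpM2l//.
(* The substitution [u = x * y] produces the factor [x^-1], whose integral over [[d, 1]] is only
   logarithmic. *)
have -> : itg d 1 (fun y => h (x * y)) = itg (x * d) (x * 1) h * x^-1.
  by rewrite itg_scale// mulrAC divff ?mul1r// gt_eqF.
rewrite ler_wpM2r ?invr_ge0 ?(ltW x0)//.
have xd0 : 0 < x * d by rewrite mulr_gt0.
apply: (@le_trans _ _ (itg (x * d) 1 h)).
  rewrite (@itg_split _ (x * 1) (x * d) 1)//; last 2 first.
  - by rewrite ler_pM2l.
  - by rewrite mulr1.
  by rewrite lerDl; apply: itg_ge0 => u _; exact: normr_ge0.
apply: (le_trans (itg_kern_diff _ _)) => //.
  by rewrite xd0/= mulr_ile1// ltW.
apply: ler_wpM2l; first by move: q1; lra.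
(* Since [d <= x], [- ln (x * d) <= - 2 * ln d], which makes the bound uniform in [x] apart from
   [x^-1]. *)
have : ln d <= ln x by rewrite ler_ln.
by rewrite lnM//; lra.
Qed.

Hypothesis ME : M = `|lam| / 2.
Hypothesis lam2 : 2 <= `|lam|.

Lemma dilation_bound x : 0 <= x <= 1 ->
  D x <= 28 * (1 - q) * `|lam| ^+ 3 * ln `|lam| ^+ 2.
Proof.
set L := `|lam|; have L0 : 0 < L by move: lam2; rewrite -/L; lra.
(* A positive lower bound on [ln L] lets constants and first powers of [ln L] be absorbed into its
   square. *)
have lL : 2^-1 <= ln L.
  apply: (@le_trans _ _ (ln 2)); last by rewrite ler_ln// posrE.
  have := @le_ln1Dx R (- 2^-1).
  have -> : 1 + - 2^-1 = 2^-1 :> R by lra.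
  by rewrite lnV ?posrE//; lra.
pose d := (L ^+ 2)^-1.
have d0 : 0 < d by rewrite invr_gt0 exprn_gt0.
have d1 : d <= 1.
  by rewrite invf_le1 ?exprn_gt0// expr_ge1// ?ltW//; move: lam2; rewrite -/L; lra.
have lnd : ln d = - (2 * ln L) by rewrite lnV ?posrE ?exprn_gt0// lnXn// mulr_natl.
set J := itg 0 1 D; set Jd := itg 0 d D.
have e0 : 0 <= 1 - q by move: q1; lra.
have J0 : 0 <= J by apply: itg_ge0 => y _; exact: normr_ge0.
have Jsplit : J = Jd + itg d 1 D by apply: itg_split => //; exact: ltW.
have Jd_le : Jd <= L / 2 * (J + 2 * (1 - q) * M) * d.
  rewrite -[X in _ * X]subr0; apply: itg_le_cst => //; first exact: ltW.
  by move=> y /andP[y0 yd]; apply: dilation_le; rewrite y0 (le_trans yd).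
(* Integration of [dilation_le_split] over [[d, 1]]; the last factor [- ln d] is the integral of
   [y^-1]. *)
have J1_le : itg d 1 D <= L / 2 * (Jd + 2 * (1 - q) * M)
    + L * M * (4 * (1 - q) * (1 - 2 * ln d)) * (- ln d).
  set A := L / 2 * _; set B := L * M * _.
  have A0 : 0 <= A.
    rewrite mulr_ge0 ?divr_ge0 ?(ltW L0)// addr_ge0//; last by rewrite !mulr_ge0.
    by apply: itg_ge0 => y _; exact: normr_ge0.
  have bB : bounded_on d 1 (fun y : R => B * y^-1).
    by apply: bounded_onM; [exact: bounded_on_cst | exact: bounded_on_inv].
  apply: (@le_trans _ _ (itg d 1 (fun y => A + B * y^-1))).
    apply: itg_le => //; first by apply: bounded_onD => //; exact: bounded_on_cst.
    by move=> y dy; exact: dilation_le_split.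
  rewrite itgD//; last exact: bounded_on_cst.
  rewrite itg_cst// itgZ; last exact: bounded_on_inv.
  rewrite itg_inv// ln1 sub0r lerD2r.
  by rewrite ler_piMr//; move: d0; lra.
move=> xh; have Dx := dilation_le xh; rewrite -/J -/L in Dx.
move: lam2 Jd_le J1_le Dx; rewrite lnd ME -/L => L2.
move: Jsplit L0 lL L2 J0 e0; set e := 1 - q; set l := ln L; set I1 := itg d 1 D.
move=> Jsplit L0 lL L2 J0 e0 Jd_le J1_le Dx.
have Ld : L ^+ 2 * d = 1 by rewrite divff// expf_neq0// gt_eqF.
(* The choice [d = L^-2] cancels both factors [L]: the one in [dilation_le] and the one multiplying
   [Jd] in [J1_le]. *)
have LJd : L * Jd <= (J + e * L) / 2.
  apply: (@le_trans _ _ (L * (L / 2 * (J + 2 * e * (L / 2)) * d))).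
    by rewrite ler_pM2l.
  have -> : L * (L / 2 * (J + 2 * e * (L / 2)) * d) =
      (L ^+ 2 * d) * ((J + e * L) / 2) by field.
  by rewrite Ld mul1r.
have eL0 : 0 <= e * L by rewrite mulr_ge0// ltW.
have Jd0 : 0 <= Jd by apply: itg_ge0 => y _; exact: normr_ge0.
have Jd4 : Jd <= (J + e * L) / 4 by nra.
have eL2 : e * L <= e * L ^+ 2 / 2 by rewrite expr2; nra.
have J1' : I1 <= (J + e * L) / 4 + e * L ^+ 2 / 2 + 4 * (e * L ^+ 2) * (l + 4 * l ^+ 2).
  apply: (le_trans J1_le); rewrite !expr2; nra.
(* [Jd] and [I1] each contribute [(J + e * L) / 4], so half of [J] moves to the left; the resulting
   [2 * e * L] is at most [e * L ^+ 2] by [eL2]. *)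
have Jle : J + e * L <= (e * L ^+ 2) * (2 + 8 * l + 32 * l ^+ 2) by lra.
(* From [l >= 1/2], [2 <= 8 l^2] and [8 l <= 16 l^2]; the prefactor [L / 2] then halves 56 to the
   final 28. *)
have l2 : 2 + 8 * l + 32 * l ^+ 2 <= 56 * l ^+ 2 by rewrite expr2; nra.
apply: (le_trans Dx).
have eLL : 0 <= e * L ^+ 2 by rewrite mulr_ge0// exprn_ge0// ltW.
apply: (@le_trans _ _ (L / 2 * ((e * L ^+ 2) * (56 * l ^+ 2)))).
  rewrite ler_pM2l ?divr_gt0//.
  have -> : J + 2 * e * (L / 2) = J + e * L by field.
  by apply: (le_trans Jle); rewrite ler_wpM2l.
by rewrite le_eqVlt; apply/orP; left; apply/eqP; field.
Qed.
End Dilation.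

(** Dilations with [q < 1] probe only the left of [x], so the left difference quotient treats
    interior points and the endpoint 1 alike. *)
Lemma deriv01_left (R : realType) (f : R -> R) x d : deriv01 f x d ->
  (fun h : R => h^-1 * (f (x + h) - f x)) @ (0 : R)^'- --> d.
Proof.
rewrite /deriv01; case: ifP => // _ [df <-].
rewrite (_ : (fun h => _) = fun h : R => h^-1 *: ((f \o shift x) (h *: 1) - f x)).
  exact: cvg_dnbhs_at_left df.
by apply/funext => h; rewrite /= [h *: 1]mulr1 (addrC h).
Qed.

(** * Normalized eigenfunctions: sup bound, dilation estimate and derivative *)

Section Eigen.
Variable R : realType.
Local Notation mu := (@lebesgue_measure R).
Local Notation itg a b f := (Rintegral mu `[a, b]%classic f).
Variables (phi : R -> R) (lam : R).
Hypothesis ephi : eigenfun phi lam.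
Hypothesis phi1 : inner01 phi phi = 1.

Let mphi : measurable_fun (`[0, 1] : set R) phi.
Proof. by case: ephi => -[]. Qed.

Let isq : mu.-integrable `[0, 1] (EFin \o (fun y => phi y ^+ 2)).
Proof.
case: ephi => -[_ fin] _; apply/integrableP; split.
  by apply/measurable_EFinP; exact: measurable_funX.
apply: le_lt_trans fin; rewrite le_eqVlt; apply/orP; left; apply/eqP.
by apply: eq_integral => y _ /=; rewrite ger0_norm ?sqr_ge0.
Qed.

Let icst (c : R) : mu.-integrable `[0, 1] (EFin \o (fun=> c)).
Proof. by apply: bounded_on_integrable; exact: bounded_on_cst. Qed.

Let sq1 : itg 0 1 (fun y => phi y ^+ 2) = 1.
Proof. by rewrite -[RHS]phi1; apply: itg_eq => y _; rewrite expr2. Qed.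

(* [|K phi| <= (1 + phi^2) / 4] integrates to [1 / 2], as [phi] has norm 1. *)
Lemma eigenfun_bound x : 0 <= x <= 1 -> `|phi x| <= `|lam| / 2.
Proof.
move=> x01; have [_ [_ ->]] := ephi => //.
rewrite normrM ler_wpM2l//.
have mK : measurable_fun (`[0, 1] : set R) (fun y => Kker x y * phi y).
  apply: measurable_funM => //.
  rewrite (_ : Kker x = fun y => kern (x * y)); last first.
    by apply/funext => y; rewrite KkerE//; case/andP: x01.
  by apply: measurable_funTS; case: (@bounded_on_kern R 0 1 x).
have iw : mu.-integrable `[0, 1] (EFin \o (fun y => 4^-1 * (1 + phi y ^+ 2))).
  have := @integrableZl _ _ R mu `[0, 1] _ 4^-1 _ (integrableD _ (icst 1) isq).
  by apply.
have le y : `|Kker x y * phi y| <= 4^-1 * (1 + phi y ^+ 2).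
  have k : `|Kker x y| <= 2^-1 by rewrite KkerE ?kern_bound//; case/andP: x01.
  have -> : 4^-1 * (1 + phi y ^+ 2) = 2^-1 * (2^-1 * (1 + `|phi y| ^+ 2)).
    by rewrite real_normK ?num_real//; field.
  rewrite normrM ler_pM//; have := sqr_ge0 (`|phi y| - 1); rewrite !expr2; nra.
have iK : mu.-integrable `[0, 1] (EFin \o (fun y => Kker x y * phi y)).
  apply: le_integrable iw => //; first exact/measurable_EFinP.
  by move=> y _; rewrite lee_fin (le_trans (le y))// ler_norm.
apply: (le_trans (le_normr_Rintegral _ iK)) => //.
apply: (@le_trans _ _ (itg 0 1 (fun y => 4^-1 * (1 + phi y ^+ 2)))).
  by apply: le_Rintegral => //; exact: integrable_norm.
rewrite RintegralZl//; last by apply: integrableD (icst 1) isq.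
rewrite RintegralD// sq1 itg_cst//; lra.
Qed.

(** The sup bound and the unit norm give [1 = int phi^2 <= (|lam| / 2)^2]. *)
Lemma eigenvalue_ge2 : 2 <= `|lam|.
Proof.
have : 1 <= (`|lam| / 2) ^+ 2.
  have <- : itg 0 1 (fun=> (`|lam| / 2) ^+ 2) = (`|lam| / 2) ^+ 2.
    by rewrite itg_cst// subr0 mulr1.
  rewrite -[leLHS]sq1.
  apply: le_Rintegral => // y; rewrite /= in_itv/= => /eigenfun_bound yM.
  by rewrite -(@real_normK _ (phi y)) ?num_real// lerXn2r ?nnegrE ?divr_ge0.
by rewrite expr_ge1// ?divr_ge0// ler_pdivlMr// mul1r.
Qed.

(** Extending [phi] by 0 outside [[0, 1]] supplies the global measurability and bound assumed in
    [dilation_bound], and changes neither the integral equation nor the values at [x] and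
    [q * x]. *)
Lemma eigenfun_dilation q x : 2^-1 <= q < 1 -> 0 <= x <= 1 ->
  `|phi (q * x) - phi x| <= 28 * (1 - q) * `|lam| ^+ 3 * ln `|lam| ^+ 2.
Proof.
move=> qh xh; pose f := phi \_ (`[0, 1] : set R).
have fphi y : 0 <= y <= 1 -> f y = phi y.
  by move=> yh; rewrite /f patchE mem_set//= in_itv.
have qxh : 0 <= q * x <= 1.
  by case/andP: qh xh => q2 q1 /andP[x0 x1]; rewrite mulr_ge0 ?mulr_ile1//; lra.
rewrite -!fphi//; apply: (dilation_bound (M := `|lam| / 2)) => //.
- by apply/(measurable_restrictT _ _).1.
- move=> y; rewrite /f patchE; case: ifPn => [|_]; last by rewrite normr0 divr_ge0.
  by rewrite inE/= in_itv/= => /eigenfun_bound.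
- move=> y yh; rewrite fphi//; have [_ [_ ->]] := ephi => //; congr (_ * _).
  by apply: itg_eq => z zh; rewrite KkerE ?fphi//; case/andP: yh.
- exact: eigenvalue_ge2.
Qed.

Lemma eigenfun_deriv x d : 0 < x <= 1 -> deriv01 phi x d ->
  `|x * d| <= 28 * `|lam| ^+ 3 * ln `|lam| ^+ 2.
Proof.
move=> /andP[x0 x1] /deriv01_left dphi.
rewrite normrM gtr0_norm// mulrC -ler_pdivlMr//.
apply: (@cvgr_to_le _ _ _ _ _ _ _ (cvg_norm dphi)).
near=> h.
have h0 : h < 0 by near: h; exact: nbhs_left_lt.
(* This keeps [q = 1 + h / x] above 1/2. *)
have hx : - (x / 2) < h by near: h; apply: nbhs_left_gt; rewrite oppr_lt0 divr_gt0.
rewrite normrM normfV ler_pdivrMl ?normr_gt0 ?lt_eqF//.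
(* Then [q * x = x + h] and [1 - q = |h| / x], so dividing the dilation bound by [|h|] leaves
   exactly the factor [x^-1]. *)
pose q := 1 + h / x.
have -> : x + h = q * x by rewrite /q mulrDl mul1r divfK// gt_eqF.
apply: (le_trans (eigenfun_dilation _ _)).
- rewrite /q; have : h / x < 0 by rewrite pmulr_llt0 ?invr_gt0.
  have : - 2^-1 < h / x by rewrite ltr_pdivlMr//; lra.
  lra.
- by rewrite (ltW x0).
have -> : 1 - q = - h / x by rewrite /q; lra.
rewrite (ltr0_norm h0) le_eqVlt; apply/orP; left; apply/eqP.
by field; rewrite gt_eqF.
Unshelve. all: by end_near. Qed.
End Eigen.

Unset Implicit Arguments.

Theorem theorem4p9 (R : realType) :
  exists C : R, 0 < C /\
  forall (phi : nat -> R -> R) (lam : nat -> R),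
    max_eigen_system phi lam ->
    forall (j : nat) (x d : R), 0 < x <= 1 ->
      deriv01 (phi j) x d ->
      `|x * d| <= C * `|lam j| ^+ 3 * (ln `|lam j|) ^+ 2.
Proof.
(* The constant of [eigenfun_deriv] is the same for every system and index; the unit norm is the
   orthonormality relation at equal indices. *)
exists 28; split => // phi lam [eig [orth _]] j x d xh dphi.
apply: (@eigenfun_deriv _ (phi j)) => //; first by case: (eig j).
by rewrite orth eqxx.
Qed.
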